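(* Let $G$ be the group given by the presentation $$G=\left\langle a,b,t \;\middle|\; t^{-1}at = b,\ t^{-1}bt = aba^{-1}\right\rangle .$$ Then $G$ contains a subgroup that is locally free but not free, and $G$ is isomorphic to a split extension (semidirect product) $F_3\rtimes \mathbb{Z}$ for some action of $\mathbb{Z}$ on $F_3$.
   Context: $F_n$ denotes a free group of rank $n$. A group is locally free if every finitely generated subgroup of it is free. *)

(* Defs.v *)
From HB Require Import structures.
From mathcomp Require Import all_boot ssralg ssrint boolp.

Set Implicit Arguments.
Unset Strict Implicit.
Unset Printing Implicit Defensive.

Local Open Scope group_scope.
Local Open Scope quotient_scope.

Definition isomorphic (G H : groupType) : Prop :=
  exists f : {multiplicative G -> H}, bijective f.

Section FreeGroup.
Variable I : choiceType.

(* The letter (i, false) stands for the generator i, and (i, true) for its    *)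
(* inverse.                                                                   *)
Definition word := seq (I * bool).

Inductive free_eqv : word -> word -> Prop :=
| free_eqv_refl u : free_eqv u u
| free_eqv_sym u v : free_eqv u v -> free_eqv v u
| free_eqv_trans v u w : free_eqv u v -> free_eqv v w -> free_eqv u w
| free_eqv_cancel u v i b :
    free_eqv (u ++ [:: (i, b); (i, ~~ b)] ++ v) (u ++ v).

Definition free_rel : rel word := fun u v => `[< free_eqv u v >].

Lemma free_rel_refl : reflexive free_rel.
Proof. by move=> u; apply/asboolP; apply: free_eqv_refl. Qed.

Lemma free_rel_sym : symmetric free_rel.
Proof. by move=> u v; apply/asboolP/asboolP; apply: free_eqv_sym. Qed.

Lemma free_rel_trans : transitive free_rel.
Proof.
move=> v u w /asboolP uv /asboolP vw.
by apply/asboolP; apply: free_eqv_trans uv vw.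
Qed.

Canonical free_rel_equiv :=
  EquivRel free_rel free_rel_refl free_rel_sym free_rel_trans.

Definition free_group := {eq_quot free_rel}.
HB.instance Definition _ := EqQuotient.on free_group.
HB.instance Definition _ := Choice.on free_group.

Lemma pi_freeP u v :
  (\pi_({eq_quot free_rel}) u = \pi_({eq_quot free_rel}) v) <-> free_eqv u v.
Proof. by split=> [/eqmodP/asboolP | uv]; last by apply/eqmodP/asboolP. Qed.

Lemma free_eqv_cat u u' v v' :
  free_eqv u u' -> free_eqv v v' -> free_eqv (u ++ v) (u' ++ v').
Proof.
move=> uu' vv'; apply: (@free_eqv_trans (u' ++ v)).
  elim: uu' => {u u'} [u|u w _|w u x _ ? _|u w i b]; first exact: free_eqv_refl.
  - exact: free_eqv_sym.
  - exact: free_eqv_trans.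
  - by rewrite -!catA; apply: free_eqv_cancel.
elim: vv' => {v v'} [v|v w _|w v x _ ? _|v w i b]; first exact: free_eqv_refl.
- exact: free_eqv_sym.
- exact: free_eqv_trans.
- by rewrite !(catA u'); apply: free_eqv_cancel.
Qed.

Definition word_inv (u : word) : word := rev [seq (x.1, ~~ x.2) | x <- u].

Lemma word_inv_cat u v : word_inv (u ++ v) = word_inv v ++ word_inv u.
Proof. by rewrite /word_inv map_cat rev_cat. Qed.

Lemma word_invK : involutive word_inv.
Proof.
move=> u; rewrite /word_inv map_rev revK -map_comp -[RHS]map_id.
by apply: eq_map => -[i b] /=; rewrite negbK.
Qed.

Lemma free_eqv_inv u v : free_eqv u v -> free_eqv (word_inv u) (word_inv v).
Proof.
elim=> {u v} [u|u w _|w u x _ ? _|u w i b]; first exact: free_eqv_refl.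
- exact: free_eqv_sym.
- exact: free_eqv_trans.
- rewrite !word_inv_cat -catA.
  suff -> : word_inv [:: (i, b); (i, ~~ b)] = [:: (i, b); (i, ~~ b)].
    exact: free_eqv_cancel.
  by rewrite /word_inv /rev /= negbK.
Qed.

Lemma free_eqv_mulV u : free_eqv (u ++ word_inv u) [::].
Proof.
elim: u => [|[i b] u IHu]; first exact: free_eqv_refl.
rewrite -cat1s word_inv_cat -catA (catA u) [word_inv _]/=.
apply: (@free_eqv_trans ([:: (i, b)] ++ [::] ++ [:: (i, ~~ b)])).
  apply: free_eqv_cat; first exact: free_eqv_refl.
  by apply: free_eqv_cat => //; apply: free_eqv_refl.
exact: (free_eqv_cancel [::] [::]).
Qed.

Definition free_mul (x y : free_group) : free_group :=
  \pi_({eq_quot free_rel}) (repr x ++ repr y).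
Definition free_inv (x : free_group) : free_group :=
  \pi_({eq_quot free_rel}) (word_inv (repr x)).
Definition free_one : free_group := \pi_({eq_quot free_rel}) [::].

Lemma repr_freeP (x : free_group) u :
  x = \pi_({eq_quot free_rel}) u -> free_eqv (repr x) u.
Proof. by move=> ->; apply/pi_freeP; rewrite reprK. Qed.

Lemma free_mulA : associative free_mul.
Proof.
move=> x y z; apply/pi_freeP.
apply: (@free_eqv_trans (repr x ++ repr y ++ repr z)).
  by apply: free_eqv_cat; [apply: free_eqv_refl | apply: repr_freeP].
rewrite catA; apply: free_eqv_sym.
by apply: free_eqv_cat; [apply: repr_freeP | apply: free_eqv_refl].
Qed.

Lemma free_mul1 : left_id free_one free_mul.
Proof.
move=> x; rewrite -[RHS]reprK; apply/pi_freeP.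
rewrite -[X in free_eqv _ X]cat0s.
by apply: free_eqv_cat; [apply: repr_freeP | apply: free_eqv_refl].
Qed.

Lemma free_mulr1 : right_id free_one free_mul.
Proof.
move=> x; rewrite -[RHS]reprK; apply/pi_freeP.
rewrite -[X in free_eqv _ X]cats0.
by apply: free_eqv_cat; [apply: free_eqv_refl | apply: repr_freeP].
Qed.

Lemma free_mulxV : right_inverse free_one free_inv free_mul.
Proof.
move=> x; apply/pi_freeP; apply: free_eqv_trans (free_eqv_mulV (repr x)).
by apply: free_eqv_cat; [apply: free_eqv_refl | apply: repr_freeP].
Qed.

Lemma free_mulVx : left_inverse free_one free_inv free_mul.
Proof.
move=> x; apply/pi_freeP.
apply: free_eqv_trans (free_eqv_mulV (word_inv (repr x))).
rewrite word_invK.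
by apply: free_eqv_cat; [apply: repr_freeP | apply: free_eqv_refl].
Qed.

HB.instance Definition _ := isGroup.Build free_group
  free_mulA free_mul1 free_mulr1 free_mulVx free_mulxV.

Definition free_gen (i : I) : free_group :=
  \pi_({eq_quot free_rel}) [:: (i, false)].

End FreeGroup.

Section Closures.
Variable G : groupType.
Implicit Type S : {pred G}.

Definition generated S : {pred G} :=
  fun x => `[< forall H : {pred G},
                 group_closed H -> {subset S <= H} -> x \in H >].

Definition normal_closed (N : {pred G}) : Prop :=
  group_closed N /\ forall x y, x \in N -> x ^ y \in N.

Definition normal_closure S : {pred G} :=
  fun x => `[< forall N : {pred G},
                 normal_closed N -> {subset S <= N} -> x \in N >].

Lemma generated_closed S : group_closed (generated S).
Proof.
split=> [|x y /asboolP Hx /asboolP Hy]; apply/asboolP => H Hcl SH.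
  by case: Hcl.
by case: (Hcl) => _; apply; [apply: Hx | apply: Hy].
Qed.

Lemma normal_closure_normal S : normal_closed (normal_closure S).
Proof.
split=> [|x y /asboolP Hx]; last first.
  by apply/asboolP => N NN SN; apply: (NN.2); apply: Hx.
split=> [|x y /asboolP Hx /asboolP Hy]; apply/asboolP => N NN SN.
  by case: NN => -[].
by case: (NN) => -[_ NV _]; apply: NV; [apply: Hx | apply: Hy].
Qed.

End Closures.

Section NormalQuotient.
Variables (G : groupType) (S : {pred G}).

Definition ncl_rel : rel G := fun x y => x / y \in normal_closure S.

Let ncl1 : 1 \in normal_closure S.
Proof. by case: (normal_closure_normal S) => -[]. Qed.
Let nclF x y : x \in normal_closure S -> y \in normal_closure S ->
  x / y \in normal_closure S.
Proof. by case: (normal_closure_normal S) => -[_ H _]; apply: H. Qed.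
Let nclV x : x \in normal_closure S -> x^-1 \in normal_closure S.
Proof. by move=> Nx; rewrite -[x^-1]mul1g; apply: nclF. Qed.
Let nclM x y : x \in normal_closure S -> y \in normal_closure S ->
  x * y \in normal_closure S.
Proof. by move=> Nx Ny; rewrite -[y]invgK; apply: nclF => //; apply: nclV. Qed.
Let nclJ x y : x \in normal_closure S -> y * x * y^-1 \in normal_closure S.
Proof.
case: (normal_closure_normal S) => _ H Nx.
by have := H x y^-1 Nx; rewrite /conjg invgK mulgA.
Qed.

Lemma ncl_rel_refl : reflexive ncl_rel.
Proof. by move=> x; rewrite /ncl_rel mulgV. Qed.

Lemma ncl_rel_sym : symmetric ncl_rel.
Proof.
by move=> x y; apply/idP/idP => /nclV; rewrite /ncl_rel invgM invgK.
Qed.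

Lemma ncl_rel_trans : transitive ncl_rel.
Proof.
by move=> y x z xy yz; have := nclM xy yz; rewrite /ncl_rel mulgA mulgVK.
Qed.

Canonical ncl_rel_equiv :=
  EquivRel ncl_rel ncl_rel_refl ncl_rel_sym ncl_rel_trans.

Definition ncl_quot := {eq_quot ncl_rel}.
HB.instance Definition _ := Choice.on ncl_quot.

Definition ncl_mul (x y : ncl_quot) : ncl_quot :=
  \pi_({eq_quot ncl_rel}) (repr x * repr y).
Definition ncl_inv (x : ncl_quot) : ncl_quot :=
  \pi_({eq_quot ncl_rel}) (repr x)^-1.
Definition ncl_one : ncl_quot := \pi_({eq_quot ncl_rel}) 1.

Lemma pi_nclP x y :
  (\pi_({eq_quot ncl_rel}) x = \pi_({eq_quot ncl_rel}) y) <-> ncl_rel x y.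
Proof. by split=> [/eqmodP | xy]; last by apply/eqmodP. Qed.

Lemma repr_nclP (x : ncl_quot) u :
  x = \pi_({eq_quot ncl_rel}) u -> ncl_rel (repr x) u.
Proof. by move=> ->; apply/pi_nclP; rewrite reprK. Qed.

Lemma ncl_relM x x' y y' :
  ncl_rel x x' -> ncl_rel y y' -> ncl_rel (x * y) (x' * y').
Proof.
move=> xx' yy'; have := nclM (nclJ x yy') xx'.
by rewrite /ncl_rel invgM !mulgA mulgVK.
Qed.

Lemma ncl_mulA : associative ncl_mul.
Proof.
move=> x y z; apply/pi_nclP.
apply: (@ncl_rel_trans (repr x * (repr y * repr z))).
  by apply: ncl_relM; [apply: ncl_rel_refl | apply: repr_nclP].
rewrite mulgA ncl_rel_sym.
by apply: ncl_relM; [apply: repr_nclP | apply: ncl_rel_refl].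
Qed.

Lemma ncl_mul1 : left_id ncl_one ncl_mul.
Proof.
move=> x; rewrite -[RHS]reprK; apply/pi_nclP; rewrite -[X in ncl_rel _ X]mul1g.
by apply: ncl_relM; [apply: repr_nclP | apply: ncl_rel_refl].
Qed.

Lemma ncl_mulr1 : right_id ncl_one ncl_mul.
Proof.
move=> x; rewrite -[RHS]reprK; apply/pi_nclP; rewrite -[X in ncl_rel _ X]mulg1.
by apply: ncl_relM; [apply: ncl_rel_refl | apply: repr_nclP].
Qed.

Lemma ncl_mulVx : left_inverse ncl_one ncl_inv ncl_mul.
Proof.
move=> x; apply/pi_nclP; rewrite -(mulVg (repr x)).
by apply: ncl_relM; [apply: repr_nclP | apply: ncl_rel_refl].
Qed.

Lemma ncl_mulxV : right_inverse ncl_one ncl_inv ncl_mul.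
Proof.
move=> x; apply/pi_nclP; rewrite -(mulgV (repr x)).
by apply: ncl_relM; [apply: ncl_rel_refl | apply: repr_nclP].
Qed.

HB.instance Definition _ := isGroup.Build ncl_quot
  ncl_mulA ncl_mul1 ncl_mulr1 ncl_mulVx ncl_mulxV.

End NormalQuotient.

(* The pair (u, v) in rels is the relation u = v.                             *)
Definition presented (I : choiceType)
    (rels : seq (free_group I * free_group I)) : groupType :=
  ncl_quot (mem [seq r.1 / r.2 | r <- rels]).

Record subgroup (G : groupType) := Subgroup {
  subgroup_pred :> {pred G};
  subgroup_closed : group_closed subgroup_pred
}.

Definition generated_subgroup (G : groupType) (S : {pred G}) : subgroup G :=
  Subgroup (generated_closed S).

Section SubgroupType.
Variables (G : groupType) (H : subgroup G).

Definition subgroup_type := {x : G | subgroup_pred H x}.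
HB.instance Definition _ := SubChoice.on subgroup_type.
HB.instance Definition _ :=
  SubChoice_isSubGroup.Build G (subgroup_pred H) subgroup_type
    (subgroup_closed H).

End SubgroupType.

(* Restricting the index set I of a basis to choice types loses nothing: a     *)
(* basis is indexed by a subset of G, which is itself a choice type.          *)
Definition is_free (G : groupType) : Prop :=
  exists I : choiceType, isomorphic (free_group I) G.

Definition locally_free (G : groupType) : Prop :=
  forall s : seq G, is_free (subgroup_type (generated_subgroup (mem s))).

(* Left actions of H on N by group automorphisms, i.e. homomorphisms          *)
(* H -> Aut(N); bijectivity of each gact h follows from the two axioms.       *)
Record group_action (H N : groupType) := GroupAction {
  gact :> H -> {multiplicative N -> N};
  gact1 : forall n, gact 1 n = n;
  gactM : forall h k n, gact (h * k) n = gact h (gact k n)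
}.

Definition semidirect (N H : groupType) (theta : group_action H N) : Type :=
  (N * H)%type.

Section SemidirectProduct.
Variables (N H : groupType) (theta : group_action H N).

Local Notation sd := (semidirect theta).
HB.instance Definition _ := Choice.copy sd (N * H)%type.

Definition sd_mul (x y : sd) : sd :=
  (x.1 * theta x.2 y.1, x.2 * y.2).
Definition sd_one : sd := (1, 1).
Definition sd_inv (x : sd) : sd :=
  (theta x.2^-1 x.1^-1, x.2^-1).

Let theta1 h : theta h 1 = 1.
Proof. by apply: (@mulgI _ (theta h 1)); rewrite -gmulfM !mulg1. Qed.

Lemma sd_mulA : associative sd_mul.
Proof. by move=> x y z; rewrite /sd_mul /= gmulfM gactM !mulgA. Qed.
Lemma sd_mul1 : left_id sd_one sd_mul.
Proof. by move=> [n h]; rewrite /sd_mul /= gact1 !mul1g. Qed.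
Lemma sd_mulr1 : right_id sd_one sd_mul.
Proof. by move=> [n h]; rewrite /sd_mul /= theta1 !mulg1. Qed.
Lemma sd_mulVx : left_inverse sd_one sd_inv sd_mul.
Proof. by move=> [n h]; rewrite /sd_mul /= -gmulfM !mulVg theta1. Qed.
Lemma sd_mulxV : right_inverse sd_one sd_inv sd_mul.
Proof. by move=> [n h]; rewrite /sd_mul /= -gactM !mulgV gact1 mulgV. Qed.

HB.instance Definition _ := isGroup.Build sd
  sd_mulA sd_mul1 sd_mulr1 sd_mulVx sd_mulxV.

End SemidirectProduct.

Definition infinite_cyclic : groupType := Algebra.to_multiplicative int.

Definition gen_a : free_group 'I_3 := free_gen (inord 0).
Definition gen_b : free_group 'I_3 := free_gen (inord 1).
Definition gen_t : free_group 'I_3 := free_gen (inord 2).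

Definition G_abt : groupType :=
  presented [:: (gen_t^-1 * gen_a * gen_t, gen_b);
                (gen_t^-1 * gen_b * gen_t, gen_a * gen_b * gen_a^-1)].

(* Main.v *)
(* Conjugation by t induces on <a, b> the endomorphism a |-> b,               *)
(* b |-> a b a^-1. It is injective on the free group on a and b, so G is an   *)
(* ascending HNN extension in which a and b generate a free group. The union  *)
(* of the chain t^n <a, b> t^-n is therefore locally free, by Nielsen and     *)
(* Schreier. All the elements t^n a t^-n and t^n b t^-n have the same image   *)
(* in its abelianization, so a basis of it would have at most one element;    *)
(* but a and b do not commute.                                                *)
(* For the splitting, put z = t a^-1, y = a^-1 z a and x = a^-2 z a^2. The    *)
(* relations become b = y^-1 z a and a z a^-1 = z y^-1 x^-1 y z, so a acts on *)
(* the free group on x, y, z by the automorphism x |-> y, y |-> z,            *)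
(* z |-> z y^-1 x^-1 y z.                                                     *)

Require Import Defs.
From HB Require Import structures.
From mathcomp Require Import all_boot ssralg ssrint boolp.

Set Implicit Arguments.
Unset Strict Implicit.
Unset Printing Implicit Defensive.

Local Open Scope group_scope.
Local Open Scope quotient_scope.

(** Write F for the free group on A and B, and phi for its endomorphism A |-> B, B |-> A B A^-1.
    Injectivity is proved by letting groups act on sets: [abt_endo_inj] reads w off the action of
    phi(w), and [ascending_embedding] realizes phi as conjugation inside a group of bijections, so F
    embeds in G ([free_to_abt_inj]). The conjugates t^n F t^-n then form an ascending chain of
    copies of F. A finitely generated subgroup of their union lies in one copy and is free by
    [nielsen_schreier].

    The union itself is not free. Every homomorphism from it to the integers is a multiple of a
    single exponent sum ([level_union_hom]), so a basis would have at most one element and the union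
    would be commutative, against [free_two_noncommutative].

    For the splitting, [abt_semidirect] trades b and t for z = t a^-1 and its conjugates y, x by a
    and a^2. What remains of the relations says that a acts on x, y, z by an automorphism of the
    free group of rank 3. The universal properties of G and of the semidirect product then give two
    mutually inverse homomorphisms. *)

Definition multiplicative_of (G H : groupType) (f : G -> H)
    (fM : {morph f : x y / x * y}) : {multiplicative G -> H} :=
  HB.pack f (isMultiplicative.Build G H f fM).

Section MultiplicativeTheory.
Variables (G H : groupType) (f : {multiplicative G -> H}).

Lemma mult1 : f 1 = 1.
Proof. by apply: (@mulgI _ (f 1)); rewrite -gmulfM !mulg1. Qed.

Lemma multV : {morph f : x / x^-1}.
Proof. by move=> x; apply/divg1_eq; rewrite invgK -gmulfM mulVg mult1. Qed.

Lemma multF : {morph f : x y / x / y}.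
Proof. by move=> x y; rewrite gmulfM multV. Qed.

Lemma multJ : {morph f : x y / x ^ y}.
Proof. by move=> x y; rewrite !gmulfM multV. Qed.

Lemma mult_inj : (forall x, f x = 1 -> x = 1) -> injective f.
Proof. by move=> fI x y xy; apply/divg1_eq/fI; rewrite multF xy divgg. Qed.

End MultiplicativeTheory.

(** * Free groups and their universal property *)

Definition word_class (I : choiceType) (u : word I) : free_group I :=
  \pi_({eq_quot (@free_rel I)}) u.

Section FreeLift.
Variables (I : choiceType) (G : groupType) (f : I -> G).

Definition letter_val (l : I * bool) : G := if l.2 then (f l.1)^-1 else f l.1.

Definition word_val (w : word I) : G := \prod_(l <- w) letter_val l.

Lemma word_val_eqv u v : free_eqv u v -> word_val u = word_val v.
Proof.
elim=> {u v} [u|u v _ ->|v u w _ -> _ ->|u v i b] //.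
rewrite /word_val !big_cat !big_cons big_nil /= /letter_val /=.
by case: b; rewrite /= ?mulg1 ?mulVg ?mulgV mul1g.
Qed.

Let lift_fun (x : free_group I) : G := word_val (repr x).

Let lift_funM : {morph lift_fun : x y / x * y}.
Proof.
move=> x y; rewrite /lift_fun -[RHS]big_cat.
exact/word_val_eqv/repr_freeP.
Qed.

Definition free_lift : {multiplicative free_group I -> G} :=
  multiplicative_of lift_funM.

Lemma free_lift_pi u : free_lift (word_class u) = word_val u.
Proof. exact/word_val_eqv/repr_freeP. Qed.

Lemma free_lift_gen i : free_lift (free_gen i) = f i.
Proof. by rewrite free_lift_pi /word_val big_seq1. Qed.

End FreeLift.

Section FreeTheory.
Variable I : choiceType.
Local Notation F := (free_group I).
Local Notation letter := (letter_val (@free_gen I)).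

Lemma letterE l : letter l = word_class [:: l].
Proof.
case: l => i [] //=; rewrite /letter_val /= /free_gen.
apply: invg_inj; rewrite invgK; apply/pi_freeP; apply: free_eqv_sym.
exact: free_eqv_inv (repr_freeP erefl).
Qed.

Lemma word_class_nil : word_class [::] = 1 :> F. Proof. by []. Qed.

Lemma word_class_cat (u v : word I) :
  word_class (u ++ v) = word_class u * word_class v.
Proof.
by apply/pi_freeP/free_eqv_sym/free_eqv_cat; apply: repr_freeP.
Qed.

Lemma word_classP (x : F) : {w | x = word_class w}.
Proof. by exists (repr x); rewrite /word_class reprK. Qed.

Lemma free_ind (P : F -> Prop) :
    P 1 -> (forall i, P (free_gen i)) ->
    (forall x y, P x -> P y -> P (x * y)) -> (forall x, P x -> P x^-1) ->
  forall x, P x.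
Proof.
move=> P1 Pgen PM PV x; have [w ->] := word_classP x.
elim: w => [//|l w IHw]; rewrite -cat1s word_class_cat; apply: PM => //.
by rewrite -letterE /letter_val; case: l.2 => //; apply: PV.
Qed.

Lemma free_hom_eq (G : groupType) (f g : {multiplicative F -> G}) :
  (forall i, f (free_gen i) = g (free_gen i)) -> f =1 g.
Proof.
move=> fg; apply: free_ind => [|//|x y fx fy|x fx]; first by rewrite !mult1.
- by rewrite !gmulfM fx fy.
- by rewrite !multV fx.
Qed.

End FreeTheory.

(** * Homomorphisms out of a presented group *)

Section Presented.
Variables (I : choiceType) (rels : seq (free_group I * free_group I)).

Definition pres_pi (x : free_group I) : presented rels :=
  \pi_({eq_quot (ncl_rel (mem [seq r.1 / r.2 | r <- rels]))}) x.

Lemma pres_piM : {morph pres_pi : x y / x * y}.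
Proof.
move=> x y; apply/pi_nclP; rewrite ncl_rel_sym.
by apply: ncl_relM; apply: repr_nclP.
Qed.
HB.instance Definition _ :=
  isMultiplicative.Build _ _ pres_pi pres_piM.

Lemma pres_pi_surj x : exists y, x = pres_pi y.
Proof. by exists (repr x); rewrite /pres_pi reprK. Qed.

Lemma pres_pi_rel r : r \in rels -> pres_pi r.1 = pres_pi r.2.
Proof.
move=> rP; apply/pi_nclP; rewrite /ncl_rel; apply/asboolP => N _; apply.
exact: (map_f (fun r => r.1 / r.2)).
Qed.

Lemma pres_hom_eq (G : groupType) (f g : {multiplicative presented rels -> G}) :
  (forall i, f (pres_pi (free_gen i)) = g (pres_pi (free_gen i))) -> f =1 g.
Proof.
move=> fg x; have [y ->] := pres_pi_surj x.
exact: (free_hom_eq (f := f \o pres_pi) (g := g \o pres_pi)).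
Qed.

Section Lift.
Variables (G : groupType) (f : {multiplicative free_group I -> G}).
Hypothesis f_rel : forall r, r \in rels -> f r.1 = f r.2.

Let ker_normal : normal_closed [pred x | f x == 1].
Proof.
split; first split=> [|x y].
- by rewrite inE mult1.
- by rewrite !inE multF => /eqP -> /eqP ->; rewrite divg1.
- by move=> x y; rewrite !inE multJ => /eqP ->; rewrite conj1g.
Qed.

Let lift_fun (x : presented rels) : G := f (repr x).

Let lift_fun_pi x : lift_fun (pres_pi x) = f x.
Proof.
have /asboolP/(_ _ ker_normal) := repr_nclP (erefl (pres_pi x)).
rewrite inE multF divg_eq1 => fP; apply/eqP/fP.
by move=> _ /mapP[r /f_rel fr ->]; rewrite inE multF fr mulgV.
Qed.

Let lift_funM : {morph lift_fun : x y / x * y}.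
Proof.
move=> x y; have [x' ->] := pres_pi_surj x; have [y' ->] := pres_pi_surj y.
by rewrite -gmulfM !lift_fun_pi gmulfM.
Qed.

Definition pres_lift : {multiplicative presented rels -> G} :=
  multiplicative_of lift_funM.

Lemma pres_liftE x : pres_lift (pres_pi x) = f x.
Proof. exact: lift_fun_pi. Qed.

End Lift.
End Presented.

(** * The group of bijections of a set *)

Record bijection (T : Type) := Bijection {
  bij_fun :> T -> T;
  bij_inv : T -> T;
  bij_funK : cancel bij_fun bij_inv;
  bij_invK : cancel bij_inv bij_fun
}.

Section Bijections.
Variable T : Type.
Implicit Types f g : bijection T.

Lemma bijection_eq f g : f =1 g -> f = g.
Proof.
case: f g => [f f' fK f'K] [g g' gK g'K] /= fg.
have {}fg : f = g by exact/funext.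
case: g / fg in gK g'K *.
have fg : f' = g' by apply/funext => x; rewrite -{1}[x]g'K fK.
case: g' / fg in gK g'K *.
by rewrite (Prop_irrelevance gK fK) (Prop_irrelevance g'K f'K).
Qed.

HB.instance Definition _ := gen_eqMixin (bijection T).
HB.instance Definition _ := gen_choiceMixin (bijection T).

Definition bij_one : bijection T :=
  @Bijection T id id (fun=> erefl) (fun=> erefl).
Definition bij_mul f g : bijection T :=
  Bijection (can_comp (bij_funK f) (bij_funK g))
            (can_comp (bij_invK g) (bij_invK f)).
Definition bij_opp f : bijection T := Bijection (bij_invK f) (bij_funK f).

Lemma bij_mulA : associative bij_mul.
Proof. by move=> f g h; apply: bijection_eq. Qed.
Lemma bij_mul1 : left_id bij_one bij_mul.
Proof. by move=> f; apply: bijection_eq. Qed.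
Lemma bij_mulr1 : right_id bij_one bij_mul.
Proof. by move=> f; apply: bijection_eq. Qed.
Lemma bij_mulVx : left_inverse bij_one bij_opp bij_mul.
Proof. by move=> f; apply: bijection_eq => x; apply: bij_funK. Qed.
Lemma bij_mulxV : right_inverse bij_one bij_opp bij_mul.
Proof. by move=> f; apply: bijection_eq => x; apply: bij_invK. Qed.

HB.instance Definition _ := isGroup.Build (bijection T)
  bij_mulA bij_mul1 bij_mulr1 bij_mulVx bij_mulxV.

Lemma bijME f g x : (f * g) x = f (g x). Proof. by []. Qed.

Lemma bijVE f x : f^-1 x = bij_inv f x. Proof. by []. Qed.

End Bijections.


(** * Integer powers as homomorphisms *)

Section IntPower.
Variables (G : groupType) (x : G).

Definition zpow_fun (n : infinite_cyclic) : G :=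
  match n : int with Posz n => x ^+ n | Negz n => x ^- n.+1 end.

(** Every integer is a difference of naturals, so this formula spares the sign cases in
    [zpow_funM]. *)
Let zpow_sub (m n : nat) : zpow_fun (m%:Z - n%:Z)%R = x ^- n * x ^+ m.
Proof.
have [mn|/ltnW mn] := leqP n m.
  by rewrite subzn // -[X in _ * x ^+ X](subnKC mn) expgnDr mulKg.
rewrite -GRing.opprB subzn // -[X in x ^- X * _](subnKC mn).
rewrite expgnDr invgM mulgVK.
by case: (n - m)%N => [|k]; rewrite ?invg1.
Qed.

Let zpow_funM : {morph zpow_fun : m n / m * n}.
Proof.
have subP (k : int) : exists m n : nat, k = (m%:Z - n%:Z)%R.
  case: k => n; first by exists n, 0; rewrite GRing.subr0.
  by exists 0, n.+1; rewrite GRing.sub0r NegzE.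
move=> m n; have [a [b ->]] := subP m; have [c [d ->]] := subP n.
have -> : ((a%:Z - b%:Z)%R : infinite_cyclic) * (c%:Z - d%:Z)%R =
  ((a + c)%N%:Z - (d + b)%N%:Z)%R.
  by rewrite !PoszD GRing.opprD [(- _ - _)%R]GRing.addrC -GRing.addrACA.
rewrite !zpow_sub !expgnDr invgM !mulgA; congr (_ * _); rewrite -!mulgA.
by congr (_ * _); apply/commute_sym/commuteV/commuteX2/commute_refl.
Qed.

Definition zpow : {multiplicative infinite_cyclic -> G} :=
  multiplicative_of zpow_funM.

End IntPower.

(** * The Nielsen-Schreier theorem *)

Section CosetRep.
Variables (G : groupType) (H : subgroup G).

Lemma subgroup1 : 1 \in subgroup_pred H.
Proof. by case: (subgroup_closed H). Qed.

Lemma subgroupF x y : x \in subgroup_pred H -> y \in subgroup_pred H ->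
  x / y \in subgroup_pred H.
Proof. by case: (subgroup_closed H) => _; apply. Qed.

Lemma subgroupV x : x \in subgroup_pred H -> x^-1 \in subgroup_pred H.
Proof. exact: (group_closedV (subgroup_closed H)). Qed.

Lemma subgroupM x y : x \in subgroup_pred H -> y \in subgroup_pred H ->
  x * y \in subgroup_pred H.
Proof. exact: (group_closedM (subgroup_closed H)). Qed.

(** Between two elements that satisfy the predicate, [choose] does not depend on its default, so the
    value is a function of the right coset H x alone. *)
Definition coset_rep (x : G) : G :=
  choose (fun y => y / x \in subgroup_pred H) x.

Lemma coset_repP x : coset_rep x / x \in subgroup_pred H.
Proof.
apply: (@chooseP _ (fun y => y / x \in subgroup_pred H) x).
by rewrite mulgV subgroup1.
Qed.

Lemma coset_rep_eq x y : x / y \in subgroup_pred H -> coset_rep x = coset_rep y.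
Proof.
move=> xy; rewrite /coset_rep.
have -> : (fun z => z / x \in subgroup_pred H) =
          (fun z => z / y \in subgroup_pred H).
  apply/funext => z; apply/idP/idP => [zx|zy].
    by have := subgroupM zx xy; rewrite mulgA mulgVK.
  by have := subgroupF zy xy; rewrite invgF mulgA mulgVK.
by apply: choose_id; rewrite ?mulgV ?subgroup1.
Qed.

Lemma coset_repK x : coset_rep (coset_rep x) = coset_rep x.
Proof. exact/coset_rep_eq/coset_repP. Qed.

End CosetRep.

Section SchreierTransversal.
Variables (I : choiceType) (H : subgroup (free_group I)).
Local Notation F := (free_group I).
Local Notation letter := (letter_val (@free_gen I)).
Local Notation inH x := (x \in subgroup_pred H).

Let reach (n : nat) (x : F) : Prop :=
  exists2 w : word I, size w = n & inH (x / word_class w).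

Let ex_reach x : exists n, `[< reach n x >].
Proof.
have [w ->] := word_classP x.
by exists (size w); apply/asboolP; exists w => //; rewrite mulgV subgroup1.
Qed.

(** The distance from H to H x in the graph of right cosets. *)
Let dist x := ex_minn (ex_reach x).

Let dist_le n x : reach n x -> dist x <= n.
Proof. by rewrite /dist; case: ex_minnP => m _ mP /asboolP/mP. Qed.

Let reach_dist x : reach (dist x) x.
Proof. by rewrite /dist; case: ex_minnP => m /asboolP. Qed.

Let reach_coset n x y : inH (x / y) -> reach n y -> reach n x.
Proof.
move=> xy [w wn yw]; exists w => //.
by have := subgroupM xy yw; rewrite mulgA mulgVK.
Qed.

Let dist_coset x y : inH (x / y) -> dist x = dist y.
Proof.
move=> xy; apply/eqP; rewrite eqn_leq !dist_le //.
  by apply: reach_coset (reach_dist x); rewrite -invgF subgroupV.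
exact: reach_coset (reach_dist y).
Qed.

(** Removing the last letter of a shortest word that leads to H x lowers the distance by exactly
    one. *)
Let step_exists x : exists o : option (I * bool),
  if o is Some l then (dist (x / letter l)).+1 = dist x else inH x.
Proof.
have [w] := reach_dist x; case/lastP: w => [_ xH|w l wl xw].
  by exists None; rewrite -[x]divg1.
rewrite size_rcons in wl; rewrite -cats1 word_class_cat -letterE in xw.
exists (Some l); apply/eqP; rewrite eqn_leq -{1}wl ltnS; apply/andP; split.
  by apply: dist_le; exists w => //; rewrite -mulgA -invgM.
have [v vd xv] := reach_dist (x / letter l).
apply: dist_le; exists (rcons v l); first by rewrite size_rcons vd.
by rewrite -cats1 word_class_cat -letterE invgM mulgA.
Qed.

(* r x is the representative of the coset H x. The last clause says that the  *)
(* set of representatives is prefix-closed. It holds because representatives  *)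
(* are built along words of minimal length.                                   *)
Lemma schreier_transversal : exists r : F -> F,
  [/\ r 1 = 1, forall x y, inH (x / y) -> r x = r y,
      forall x, inH (r x / x) &
      forall P : F -> Prop, P 1 ->
        (forall x l, P (r x) -> r (r x * letter l) = r x * letter l ->
          P (r x * letter l)) ->
        forall x, P (r x)].
Proof.
have [step stepP] := choice step_exists.
(* The first argument is fuel. As [dist] drops by one, the fuel [(dist x).+1] makes the recursive
   call equal to [r] of the nearer coset. Passing to [coset_rep H x] makes the value depend on the
   coset only. *)
pose fix s (n : nat) (x : F) {struct n} : F := if n is m.+1 then
  let y := coset_rep H x in
  if step y is Some l then s m (y / letter l) * letter l else 1 else 1.
pose r x := s (dist x).+1 x.
have r_coset x y : inH (x / y) -> r x = r y.
  by move=> xy; rewrite /r (dist_coset xy) /= (coset_rep_eq xy).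
have rP x : (inH x /\ r x = 1) \/
    exists y l, [/\ dist x = (dist y).+1, inH (y * letter l / x) &
                  r x = r y * letter l].
  have := stepP (coset_rep H x); have cx := coset_repP H x.
  have : r x = if step (coset_rep H x) is Some l
    then s (dist x) (coset_rep H x / letter l) * letter l else 1 by [].
  case: (step _) => [l|] rx yl; [right | left; split=> //].
    exists (coset_rep H x / letter l), l; rewrite mulgVK; split=> //.
      by rewrite yl (dist_coset cx).
    by rewrite rx /r yl (dist_coset cx).
  rewrite -(invgK x) subgroupV // -(mulKg (coset_rep H x) x^-1).
  by rewrite subgroupM ?subgroupV.
have r_in x : inH (r x / x).
  move: {2}(dist x) (erefl (dist x)) => n; elim: n x => [|n IHn] x xn.
    case: (rP x) => [[xH ->]|[y [l [yx _ _]]]]; last by rewrite yx in xn.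
    by rewrite subgroupF ?subgroup1.
  case: (rP x) => [[xH ->]|[y [l [yx ylx ->]]]].
    by rewrite subgroupF ?subgroup1.
  have := IHn y; rewrite yx in xn; case: xn => -> /(_ erefl) yH.
  have := subgroupM yH ylx; rewrite !mulgA mulgVK //.
exists r; split=> //.
  case: (rP 1) => [[]//|[y [l [yx _ _]]]].
  suff : dist 1 <= 0 by rewrite yx.
  by apply: dist_le; exists [::]; rewrite ?mulgV ?subgroup1.
move=> P P1 PM x.
move: {2}(dist x) (erefl (dist x)) => n; elim: n x => [|n IHn] x xn.
  by case: (rP x) => [[_ ->//]|[y [l [yx _ _]]]]; rewrite yx in xn.
case: (rP x) => [[_ ->//]|[y [l [yx ylx rx]]]].
rewrite yx in xn; case: xn => /IHn yP.
rewrite rx; apply: PM => //; rewrite -rx; apply: r_coset.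
by have := subgroupM (r_in y) ylx; rewrite rx !mulgA mulgVK.
Qed.

End SchreierTransversal.

Section NielsenSchreier.
Variables (I : choiceType) (H : subgroup (free_group I)).
Local Notation F := (free_group I).
Local Notation gen := (@free_gen I).
Local Notation letter := (letter_val gen).
Local Notation inH x := (x \in subgroup_pred H).

Variable r : F -> F.
Hypothesis r1 : r 1 = 1.
Hypothesis r_coset : forall x y, inH (x / y) -> r x = r y.
Hypothesis r_in : forall x, inH (r x / x).
Hypothesis r_ind : forall P : F -> Prop, P 1 ->
  (forall x l, P (r x) -> r (r x * letter l) = r x * letter l ->
     P (r x * letter l)) ->
  forall x, P (r x).

Let r_H x : inH x -> r x = 1.
Proof. by move=> xH; rewrite -r1; apply: r_coset; rewrite divg1. Qed.

Let rr x : r (r x) = r x. Proof. exact/r_coset/r_in. Qed.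

Let rrM x y : r (r x * y) = r (x * y).
Proof. by apply: r_coset; rewrite mulgKA. Qed.

Let sgen (p : F * I) : F := p.1 * gen p.2 / r (p.1 * gen p.2).

(* sgen is trivial on the edges of the spanning tree given by r, and these    *)
(* are excluded from the basis.                                               *)
Let basis_pred : pred (F * I) := fun p => (r p.1 == p.1) && (sgen p != 1).

Let basis : choiceType := {p : F * I | basis_pred p}.
Local Notation FY := (free_group basis).

Let phi : {multiplicative FY -> F} := free_lift (fun p : basis => sgen (val p)).

Let sgen_in p : inH (sgen p).
Proof. by rewrite /sgen -invgF subgroupV // r_in. Qed.

Let phi_in y : inH (phi y).
Proof.
elim/free_ind: y => [|p|x y xH yH|x xH].
- by rewrite mult1 subgroup1.
- by rewrite free_lift_gen sgen_in.
- by rewrite gmulfM subgroupM.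
- by rewrite multV subgroupV.
Qed.

(** The label of an edge of the coset graph. The default 1 is taken on tree edges, where [sgen] is
    trivial. *)
Let ygen (x : F) (i : I) : FY :=
  if insub (r x, i) is Some p then free_gen p else 1.

Let phi_ygen x i : phi (ygen x i) = r x * gen i / r (x * gen i).
Proof.
rewrite /ygen; case: insubP => [p _ pE|].
  by rewrite free_lift_gen pE /sgen /= rrM.
by rewrite mult1 /basis_pred /= rr eqxx negbK /sgen /= rrM => /eqP.
Qed.

Let ylet (x : F) (l : I * bool) : FY :=
  if l.2 then (ygen (x / gen l.1) l.1)^-1 else ygen x l.1.

Let phi_ylet x l : phi (ylet x l) = r x * letter l / r (x * letter l).
Proof.
rewrite /ylet /letter_val; case: l.2; last exact: phi_ygen.
by rewrite multV phi_ygen invgF mulgVK invgM mulgA.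
Qed.

(* The word in the Schreier generators that is read along w in the coset      *)
(* graph, starting from H x. On H, x |-> cocycle 1 x inverts phi.             *)
Fixpoint cocycle_word (x : F) (w : word I) : FY :=
  if w is l :: w' then ylet x l * cocycle_word (x * letter l) w' else 1.

Let cocycle_cat x u v : cocycle_word x (u ++ v) =
  cocycle_word x u * cocycle_word (x * word_class u) v.
Proof.
elim: u x => [|l u IHu] x /=.
  by rewrite mul1g word_class_nil mulg1.
by rewrite IHu mulgA -[l :: u]cat1s word_class_cat -letterE mulgA.
Qed.

Let cocycle_eqv u v : free_eqv u v ->
  forall x, cocycle_word x u = cocycle_word x v.
Proof.
elim=> {u v} [u x|u v _ IH x|u v w _ IH1 _ IH2 x|u v i b x] //.
  by rewrite IH1.
rewrite !cocycle_cat.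
have -> : word_class [:: (i, b); (i, ~~ b)] = 1.
  exact/pi_freeP/(free_eqv_cancel [::] [::]).
rewrite mulg1 /= mulg1 /ylet /letter_val.
by case: b => /=; rewrite ?mulgK (mulgV, mulVg) mul1g.
Qed.

Let cocycle (x y : F) : FY := cocycle_word x (repr y).

Let cocycle_class x w : cocycle x (word_class w) = cocycle_word x w.
Proof. exact/cocycle_eqv/repr_freeP. Qed.

Let cocycleM x y z : cocycle x (y * z) = cocycle x y * cocycle (x * y) z.
Proof.
have [[u ->] [v ->]] := (word_classP y, word_classP z).
by rewrite -word_class_cat !cocycle_class cocycle_cat.
Qed.

Let cocycle_letter x l : cocycle x (letter l) = ylet x l.
Proof. by rewrite letterE cocycle_class /= mulg1. Qed.

Let cocycle1 x : cocycle x 1 = 1.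
Proof. exact: (cocycle_class x [::]). Qed.

Let cocycle_coset x y z : inH (x / y) -> cocycle x z = cocycle y z.
Proof.
rewrite /cocycle; elim: (repr z) x y => [|l w IHw] x y xy //=.
have xyM g : inH (x * g / (y * g)) by rewrite mulgKA.
by rewrite (IHw _ _ (xyM _)) /ylet /ygen (r_coset xy) (r_coset (xyM _)).
Qed.

(** The product telescopes along the path. For [x = 1] and [y] in H both representatives are 1,
    which gives one of the two inverse laws. *)
Let phi_cocycle x y : phi (cocycle x y) = r x * y / r (x * y).
Proof.
rewrite /cocycle; have [w ->] := word_classP y.
rewrite (cocycle_eqv (repr_freeP erefl)).
elim: w x => [|l w IHw] x.
  by rewrite word_class_nil !mulg1 mulgV -[RHS](mult1 phi).
rewrite [cocycle_word _ _]/(ylet x l * cocycle_word _ w) gmulfM IHw phi_ylet.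
rewrite -[l :: w]cat1s word_class_cat -letterE.
by rewrite !mulgA mulgVK.
Qed.

(** By prefix-closure a representative is spelled along tree edges, and these carry the label 1. *)
Let cocycle_r x : cocycle 1 (r x) = 1.
Proof.
apply: (r_ind (P := fun z => cocycle 1 z = 1)) => [|{}x l IHx rE].
  exact: cocycle1.
rewrite cocycleM IHx mul1g mul1g cocycle_letter /ylet.
have trivial_ygen y i : r y * gen i / r (y * gen i) = 1 -> ygen y i = 1.
  move=> yi; rewrite /ygen; case: insubP => // p /andP[_ /=].
  by rewrite /sgen /= rrM yi eqxx.
move: rE; rewrite /letter_val; case: l => i [] /= rE; last first.
  by apply: trivial_ygen; rewrite rE rr mulgV.
by rewrite trivial_ygen ?invg1 // mulgVK rE rr mulgVK mulgV.
Qed.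

Let cocycle_rV x : cocycle (r x) (r x)^-1 = 1.
Proof.
by have := cocycleM 1 (r x) (r x)^-1; rewrite mulgV cocycle1 cocycle_r !mul1g.
Qed.

(** For a basis element, the path runs along a representative, crosses one edge and returns along an
    inverse representative, so only the label of that edge survives. On products, the crossed rule
    [cocycleM] becomes multiplicative by [cocycle_coset], since [phi] takes values in H. *)
Let psi_phi y : cocycle 1 (phi y) = y.
Proof.
elim/free_ind: y => [|p|x y xE yE|x xE].
- by rewrite mult1 cocycle1.
- have /andP[/eqP rp sp] := valP p.
  rewrite free_lift_gen /sgen !cocycleM -{1}rp cocycle_r !mul1g.
  set z := (val p).1 * gen (val p).2.
  rewrite [X in _ * X](cocycle_coset (y := r z)); last first.
    by rewrite -invgF subgroupV // r_in.
  rewrite cocycle_rV mulg1 -[gen _]/(letter (_, false)) cocycle_letter /ylet /=.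
  rewrite /ygen rp -surjective_pairing.
  by rewrite valK.
- rewrite gmulfM cocycleM xE mul1g (cocycle_coset (y := 1)) ?yE //.
  by rewrite divg1.
- rewrite multV; have := cocycleM 1 (phi x)^-1 (phi x).
  rewrite mulVg cocycle1 mul1g [X in _ * X](cocycle_coset (y := 1)); last first.
    by rewrite divg1 subgroupV.
  by rewrite xE => /esym/eqP; rewrite mulg_eq1 => /eqP.
Qed.

Let subgroup_phi (y : FY) : subgroup_type H := Sub (phi y) (phi_in y).

Let subgroup_phiM : {morph subgroup_phi : x y / x * y}.
Proof. by move=> x y; apply: val_inj; rewrite valM !SubK gmulfM. Qed.

Lemma schreier_free : is_free (subgroup_type H).
Proof.
exists basis, (multiplicative_of subgroup_phiM).
exists (fun h => cocycle 1 (val h)) => [y|h]; first exact: psi_phi.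
apply: val_inj; rewrite SubK phi_cocycle.
by rewrite mul1g r1 mul1g r_H ?divg1 //; apply: valP.
Qed.

End NielsenSchreier.

Theorem nielsen_schreier (I : choiceType) (H : subgroup (free_group I)) :
  is_free (subgroup_type H).
Proof.
have [r [r1 r_coset r_in r_ind]] := schreier_transversal H.
exact: (schreier_free r1 r_coset r_in r_ind).
Qed.

(** * Transfer of freeness, and exponent sums *)

Lemma isomorphic_trans (G H K : groupType) :
  isomorphic G H -> isomorphic H K -> isomorphic G K.
Proof.
move=> [f fB] [g gB]; exists (g \o f : {multiplicative G -> K}).
exact: bij_comp.
Qed.

(** The map f^-1 g identifies G with a subgroup of the free group, to which [nielsen_schreier]
    applies. *)
Lemma is_free_of_embedding (I : choiceType) (G K : groupType)
    (f : {multiplicative free_group I -> K}) (g : {multiplicative G -> K}) :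
  injective f -> injective g -> (forall x, exists w, f w = g x) -> is_free G.
Proof.
move=> f_inj g_inj fg.
pose P : {pred free_group I} := fun w => `[< exists x, f w = g x >].
have P_closed : group_closed P.
  split=> [|w v /asboolP[x wx] /asboolP[y vy]]; apply/asboolP.
    by exists 1; rewrite !mult1.
  by exists (x / y); rewrite !multF wx vy.
have [pre preP] := choice fg.
have pre_in x : subgroup_pred (Subgroup P_closed) (pre x).
  by apply/asboolP; exists x.
pose h x : subgroup_type (Subgroup P_closed) := Sub (pre x) (pre_in x).
have hM : {morph h : x y / x * y}.
  move=> x y; apply: val_inj; rewrite valM !SubK; apply: f_inj.
  by rewrite gmulfM !preP gmulfM.
have [J freeJ] := nielsen_schreier (Subgroup P_closed).
exists J; apply: isomorphic_trans freeJ _.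
have /choice[k kP] : forall w : subgroup_type (Subgroup P_closed), exists x,
    f (val w) = g x.
  by move=> w; apply/asboolP; apply: (valP w).
have hK : cancel h k by move=> x; apply: g_inj; rewrite -kP SubK preP.
have kK : cancel k h.
  by move=> w; apply: val_inj; apply: f_inj; rewrite SubK preP kP.
exists (multiplicative_of (can2_gmulfM (f := multiplicative_of hM) hK kK)).
by exists h.
Qed.

Section Abelianization.
Variable I : choiceType.

Definition coord (i : I) : {multiplicative free_group I -> infinite_cyclic} :=
  free_lift (fun j => ((j == i)%:Z)%R : infinite_cyclic).

Lemma coord_gen i j : coord i (free_gen j) = ((j == i)%:Z)%R.
Proof. exact: free_lift_gen. Qed.

Lemma free_group_commutative :
    (forall i j : I, i = j) -> forall x y : free_group I, x * y = y * x.
Proof.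
move=> I1.
have gen_comm (i : I) x : commute (free_gen i) x.
  elim/free_ind: x => [|j|x y|x]; [exact: commute1|..].
  - by rewrite (I1 i j); apply: commute_refl.
  - exact: commuteM.
  - exact: commuteV.
move=> x y; rewrite -[_ = _]/(commute x y).
elim/free_ind: y => [|i|y z|y]; [exact: commute1|..].
- exact: commute_sym.
- exact: commuteM.
- exact: commuteV.
Qed.

End Abelianization.

(** * The ascending HNN extension *)

Section AscendingHNN.
Variables (F : groupType) (phi : {multiplicative F -> F}).
Hypothesis phi_inj : injective phi.

Let image : {pred F} := fun x => `[< exists y, x = phi y >].

Let image_closed : group_closed image.
Proof.
split=> [|_ _ /asboolP[x ->] /asboolP[y ->]]; apply/asboolP.
  by exists 1; rewrite mult1.
by exists (x / y); rewrite multF.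
Qed.

Local Notation c := (coset_rep (Subgroup image_closed)).

Lemma ascending_embedding : exists (P : groupType) (t : P)
    (lam : {multiplicative F -> P}),
  injective lam /\ forall x, t^-1 * lam x * t = lam (phi x).
Proof.
(* Every element of F is uniquely phi x * y with x in F and y in C, hence the *)
(* map down below is bijective. It intertwines translation by x with          *)
(* translation by phi x, so t is its inverse.                                 *)
pose C := {x : F | c x == x}.
have cC x : c (c x) == c x by rewrite coset_repK.
have /choice[q qP] : forall x, exists y, x = phi y * c x.
  move=> x; have : image (x / c x).
    by have := subgroupV (coset_repP (Subgroup image_closed) x); rewrite invgF.
  by case/asboolP=> y xy; exists y; rewrite -xy mulgVK.
(* The sequence serves as a stack: [up] pushes the coset representative of the first component, and
   [down] pops it. Infinite length keeps [down] total. *)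
pose X := (F * (nat -> C))%type.
pose down (z : X) : X := (phi z.1 * val (z.2 0), fun n => z.2 n.+1).
pose up (z : X) : X :=
  (q z.1, fun n => if n is m.+1 then z.2 m else exist _ (c z.1) (cC z.1)).
have c_phi x (y : C) : c (phi x * val y) = val y.
  rewrite -[RHS](eqP (valP y)); apply: coset_rep_eq; rewrite mulgK.
  by apply/asboolP; exists x.
have downK : cancel down up.
  case=> x m; congr (_, _) => /=.
    apply: phi_inj; apply: (@mulIg _ (val (m 0))).
    by rewrite -{1}(c_phi x (m 0)) -qP.
  by apply/funext; case=> //=; apply: val_inj; rewrite /= c_phi.
have upK : cancel up down by case=> x m; rewrite /down /up /= -qP.
have translateK x : cancel (fun z : X => (x * z.1, z.2))
                           (fun z => (x^-1 * z.1, z.2)).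
  by case=> y m; rewrite /= mulKg.
have translateVK x : cancel (fun z : X => (x^-1 * z.1, z.2))
                            (fun z => (x * z.1, z.2)).
  by case=> y m; rewrite /= mulVKg.
pose translate x := Bijection (translateK x) (translateVK x).
have translateM : {morph translate : x y / x * y}.
  by move=> x y; apply: bijection_eq => z; rewrite bijME /= mulgA.
exists (bijection X), (Bijection upK downK), (multiplicative_of translateM).
split=> [|x]; last first.
  apply: bijection_eq => -[y m].
  by rewrite !bijME bijVE /= /down /= gmulfM -mulgA -qP.
pose z : X := (1, fun=> exist _ (c 1) (cC 1)).
apply: mult_inj => x /(congr1 (fun f : bijection X => (f z).1)).
by rewrite /= mulg1.
Qed.

End AscendingHNN.

(** * The group G and homomorphisms out of it *)

Definition abt_a : G_abt := pres_pi _ gen_a.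
Definition abt_b : G_abt := pres_pi _ gen_b.
Definition abt_t : G_abt := pres_pi _ gen_t.

Lemma abt_rel_a : abt_t^-1 * abt_a * abt_t = abt_b.
Proof.
rewrite /abt_t /abt_a /abt_b -(multV (pres_pi _)) -!gmulfM.
by apply: (pres_pi_rel (r := (_, _))); rewrite mem_head.
Qed.

Lemma abt_rel_b : abt_t^-1 * abt_b * abt_t = abt_a * abt_b * abt_a^-1.
Proof.
rewrite /abt_t /abt_a /abt_b -!(multV (pres_pi _)) -!gmulfM.
by apply: (pres_pi_rel (r := (_, _))); rewrite in_cons mem_head orbT.
Qed.

Lemma ord3_ind (P : 'I_3 -> Prop) :
  P (inord 0) -> P (inord 1) -> P (inord 2) -> forall i, P i.
Proof.
move=> P0 P1 P2 i; rewrite -(inord_val i).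
by case: i => -[|[|[|]]].
Qed.

Section FreeThree.
Variables (G : groupType) (x y z : G).

Definition lift3 : {multiplicative free_group 'I_3 -> G} :=
  free_lift (fun i : 'I_3 => nth 1 [:: x; y; z] i).

Lemma lift3_0 : lift3 (free_gen (inord 0)) = x.
Proof. by rewrite /lift3 free_lift_gen inordK. Qed.
Lemma lift3_1 : lift3 (free_gen (inord 1)) = y.
Proof. by rewrite /lift3 free_lift_gen inordK. Qed.
Lemma lift3_2 : lift3 (free_gen (inord 2)) = z.
Proof. by rewrite /lift3 free_lift_gen inordK. Qed.
Definition lift3E := (lift3_0, lift3_1, lift3_2).

End FreeThree.

Lemma abt_lift (G : groupType) (x y z : G) :
    z^-1 * x * z = y -> z^-1 * y * z = x * y * x^-1 ->
  exists f : {multiplicative G_abt -> G},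
    [/\ f abt_a = x, f abt_b = y & f abt_t = z].
Proof.
move=> xz yz.
have rel r : r \in [:: (gen_t^-1 * gen_a * gen_t, gen_b);
    (gen_t^-1 * gen_b * gen_t, gen_a * gen_b * gen_a^-1)] ->
    lift3 x y z r.1 = lift3 x y z r.2.
  rewrite !inE => /orP[] /eqP ->; rewrite [fst _]/= [snd _]/=.
    by rewrite !(gmulfM, multV) !lift3E.
  by rewrite !(gmulfM, multV) !lift3E.
by exists (pres_lift rel); rewrite /abt_a /abt_b /abt_t !pres_liftE !lift3E.
Qed.

Lemma abt_hom_eq (G : groupType) (f g : {multiplicative G_abt -> G}) :
  f abt_a = g abt_a -> f abt_b = g abt_b -> f abt_t = g abt_t -> f =1 g.
Proof. by move=> fga fgb fgt; apply: pres_hom_eq; apply: ord3_ind. Qed.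

Lemma infinite_cyclicC (m n : infinite_cyclic) : m * n = n * m.
Proof. exact: GRing.addrC. Qed.

(** * The locally free subgroup that is not free *)

Section FreeTwo.
Local Notation F := (free_group bool).
Local Notation A := (free_gen false).
Local Notation B := (free_gen true).

Definition abt_endo : {multiplicative F -> F} :=
  free_lift (fun b : bool => if b then A * B * A^-1 else B).

Lemma abt_endo_A : abt_endo A = B. Proof. exact: free_lift_gen. Qed.

Lemma abt_endo_B : abt_endo B = A * B * A^-1. Proof. exact: free_lift_gen. Qed.

Lemma abt_endo_inj : injective abt_endo.
Proof.
(* a exchanges two copies of F, and b multiplies by a on the copy false and   *)
(* by b on the copy true. Then b and a b a^-1 act on the copy false as left   *)
(* multiplication by a and b.                                                 *)
have swapK : involutive (fun z : F * bool => (z.1, ~~ z.2)).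
  by case=> x b; rewrite /= negbK.
pose m (b : bool) : F := if b then B else A.
have actK : cancel (fun z : F * bool => (m z.2 * z.1, z.2))
                   (fun z => ((m z.2)^-1 * z.1, z.2)).
  by case=> x b; rewrite /= mulKg.
have actVK : cancel (fun z : F * bool => ((m z.2)^-1 * z.1, z.2))
                    (fun z => (m z.2 * z.1, z.2)).
  by case=> x b; rewrite /= mulVKg.
pose f : {multiplicative F -> bijection (F * bool)} :=
  free_lift (fun b : bool =>
    if b then Bijection actK actVK else Bijection swapK swapK).
have fA : f A = Bijection swapK swapK by apply: free_lift_gen.
have fB : f B = Bijection actK actVK by apply: free_lift_gen.
have f_endo w v : f (abt_endo w) (v, false) = (w * v, false).
  elim/free_ind: w v => [|[]|x y IHx IHy|x IHx] v.
  - by rewrite !mult1 mul1g.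
  - by rewrite abt_endo_B !(gmulfM, multV) fA fB.
  - by rewrite abt_endo_A fB.
  - by rewrite !gmulfM bijME IHy IHx mulgA.
  - by rewrite !multV bijVE -{1}[v](mulVKg x) -IHx bij_funK.
apply: mult_inj => w /(congr1 f).
move=> /(congr1 (fun g : bijection (F * bool) => g (1, false))).
by rewrite f_endo mult1 mulg1 => -[].
Qed.

(** Otherwise phi(B) = A B A^-1 would equal B = phi(A), hence A = B, which the exponent sum of B
    refutes. *)
Lemma free_two_noncommutative : A * B <> B * A.
Proof.
move=> AB; have /abt_endo_inj/(congr1 (coord true)) : abt_endo A = abt_endo B.
  by rewrite abt_endo_A abt_endo_B AB mulgK.
by rewrite !coord_gen.
Qed.

Definition free_to_abt : {multiplicative F -> G_abt} :=
  free_lift (fun b : bool => if b then abt_b else abt_a).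

Lemma free_to_abt_endo w :
  abt_t^-1 * free_to_abt w * abt_t = free_to_abt (abt_endo w).
Proof.
transitivity (free_to_abt w ^ abt_t); first by rewrite conjgE mulgA.
elim/free_ind: w => [|b|x y IHx IHy|x IHx].
- by rewrite !mult1 conj1g.
- rewrite conjgE mulgA /free_to_abt free_lift_gen -/free_to_abt; case: b.
    by rewrite abt_endo_B !(gmulfM, multV) !free_lift_gen abt_rel_b.
  by rewrite abt_endo_A free_lift_gen abt_rel_a.
- by rewrite !gmulfM conjMg IHx IHy.
- by rewrite !multV conjVg IHx.
Qed.

Lemma free_to_abt_A : free_to_abt A = abt_a. Proof. exact: free_lift_gen. Qed.

Lemma free_to_abt_B : free_to_abt B = abt_b. Proof. exact: free_lift_gen. Qed.

(** The group of [ascending_embedding] satisfies the relations of G, and the resulting homomorphism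
    from G composes with [free_to_abt] to the injective [lam]. *)
Lemma free_to_abt_inj : injective free_to_abt.
Proof.
have [P [t [lam [lam_inj lamt]]]] := ascending_embedding abt_endo_inj.
have [|| f [fa fb ft]] := @abt_lift P (lam A) (lam B) t.
- by rewrite lamt abt_endo_A.
- by rewrite lamt abt_endo_B !(gmulfM, multV).
have f_free_to_abt : f \o free_to_abt =1 lam.
  apply: (free_hom_eq (f := f \o free_to_abt)) => -[].
    exact: etrans (congr1 f free_to_abt_B) fb.
  exact: etrans (congr1 f free_to_abt_A) fa.
by apply: (@inj_compr _ _ _ f); apply: eq_inj lam_inj (fsym f_free_to_abt).
Qed.

Let level_fun (n : nat) (w : F) : G_abt :=
  abt_t ^+ n * free_to_abt w * abt_t ^- n.

Let level_funM n : {morph level_fun n : u v / u * v}.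
Proof. by move=> u v; rewrite /level_fun gmulfM !mulgA mulgVK. Qed.

Definition level n : {multiplicative F -> G_abt} :=
  multiplicative_of (level_funM n).

Lemma level_inj n : injective (level n).
Proof. by move=> u v /mulIg/mulgI/free_to_abt_inj. Qed.

(** Since t^-1 F t is phi(F), each level is contained in the next. *)
Lemma level_endo n w : level n w = level n.+1 (abt_endo w).
Proof.
apply: (_ : level_fun n w = level_fun n.+1 (abt_endo w)).
by rewrite /level_fun -free_to_abt_endo expgSr invgM !mulgA !mulgK.
Qed.

Lemma level_le m n w : (m <= n)%N -> exists v, level m w = level n v.
Proof.
move=> /subnKC <-; elim: (n - m)%N w => [|k IHk] w.
  by exists w; rewrite addn0.
by have [v ->] := IHk w; exists (abt_endo v); rewrite addnS level_endo.
Qed.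

Definition levels : {pred G_abt} := fun x => `[< exists n w, x = level n w >].

Lemma levels_closed : group_closed levels.
Proof.
split=> [|_ _ /asboolP[m [u ->]] /asboolP[n [v ->]]]; apply/asboolP.
  by exists 0, 1; rewrite mult1.
have [u' ->] := level_le u (leq_maxl m n).
have [v' ->] := level_le v (leq_maxr m n).
by exists (maxn m n), (u' / v'); rewrite multF.
Qed.

Definition level_union : subgroup G_abt := Subgroup levels_closed.

Lemma level_unionP (x : subgroup_type level_union) :
  exists n w, val x = level n w.
Proof. by apply/asboolP; apply: (valP x). Qed.

Lemma level_in n w : subgroup_pred level_union (level n w).
Proof. by apply/asboolP; exists n, w. Qed.

(** Finitely many elements lie in one level, and so does the subgroup they generate; [level n]
    identifies it with a subgroup of F. *)
Lemma level_union_locally_free : locally_free (subgroup_type level_union).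
Proof.
move=> s.
have [n nP] : exists n, forall x, x \in s -> exists w, val x = level n w.
  elim: s => [|x s [n IHs]]; first by exists 0.
  have [m [u xu]] := level_unionP x; exists (maxn m n) => y.
  rewrite inE => /orP[/eqP ->|/IHs[v ->]].
    by rewrite xu; apply: level_le; apply: leq_maxl.
  by apply: level_le; apply: leq_maxr.
pose Ln : {pred subgroup_type level_union} :=
  fun x => `[< exists w, val x = level n w >].
have Ln_closed : group_closed Ln.
  split=> [|x y /asboolP[u xu] /asboolP[v yv]]; apply/asboolP.
    by exists 1; rewrite !mult1.
  by exists (u / v); rewrite (multF (level n)) -xu -yv; apply: (multF val).
pose j : {multiplicative subgroup_type (generated_subgroup (mem s)) -> G_abt} :=
  val \o val.
apply: (is_free_of_embedding (f := level n) (g := j)).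
- exact: level_inj.
- exact: inj_comp val_inj val_inj.
- move=> x; have /asboolP/(_ Ln Ln_closed) xLn := valP x.
  have /asboolP[w xw] : val x \in Ln by apply: xLn => y /nP ?; apply/asboolP.
  by exists w.
Qed.

Let elt_fun n w : subgroup_type level_union := Sub (level n w) (level_in n w).

Let elt_funM n : {morph elt_fun n : u v / u * v}.
Proof. by move=> u v; apply: val_inj; rewrite valM !SubK gmulfM. Qed.

Let elt n := multiplicative_of (elt_funM n).

Let eltE n w : val (elt n w) = level n w.
Proof. exact: SubK. Qed.

Let elt_endo n w : elt n w = elt n.+1 (abt_endo w).
Proof. by apply: val_inj; rewrite !eltE level_endo. Qed.

Let elt_surj x : exists n w, x = elt n w.
Proof.
by have [n [w xw]] := level_unionP x; exists n, w; apply: val_inj; rewrite eltE.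
Qed.

(** Seen in level n+1, A and B of level n are B and a conjugate of B, so [h] agrees on them. As A of
    level n is B of level n+1, the common value is the same in all levels. The [free_lift] is the
    total exponent sum. *)
Lemma level_union_hom
    (h : {multiplicative subgroup_type level_union -> infinite_cyclic}) :
  exists c : int, forall n w,
    h (elt n w) = (c * free_lift (fun=> 1%R : infinite_cyclic) w)%R.
Proof.
have hAB n : h (elt n B) = h (elt n A).
  rewrite elt_endo abt_endo_B [elt n A]elt_endo abt_endo_A.
  by rewrite [elt _ _]gmulfM [h _]gmulfM infinite_cyclicC -!gmulfM mulKg.
have hA n : h (elt n A) = h (elt 0 A).
  by elim: n => // n <-; rewrite -hAB -abt_endo_A -elt_endo.
have scaleM (c : int) : {morph (fun z : infinite_cyclic => (c * (z : int))%R
    : infinite_cyclic) : x y / x * y}.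
  by move=> x y; apply: GRing.mulrDr.
exists (h (elt 0 A)) => n w.
pose scale := multiplicative_of (scaleM (h (elt 0 A))).
apply: (free_hom_eq (f := h \o elt n) (g := scale \o free_lift _)) => b.
apply: etrans (esym (congr1 scale (free_lift_gen _ b))).
apply: etrans (esym (GRing.mulr1 _)).
by case: b; [rewrite -(hA n) -hAB | exact: hA].
Qed.

(** Any two homomorphisms to the integers are proportional, so their 2 x 2 determinants vanish. On
    the coordinates of two distinct basis elements the determinant would be 1. *)
Lemma level_union_homs
    (f g : {multiplicative subgroup_type level_union -> infinite_cyclic}) x y :
  ((f x : int) * g y = (f y : int) * g x)%R.
Proof.
have [[c fE] [d gE]] := (level_union_hom f, level_union_hom g).
have [m [u ->]] := elt_surj x; have [n [v ->]] := elt_surj y.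
by rewrite !fE !gE GRing.mulrACA [in RHS]GRing.mulrACA; congr (_ * _)%R;
  apply: GRing.mulrC.
Qed.

Lemma level_union_not_free : ~ is_free (subgroup_type level_union).
Proof.
case=> I [f [g fK gK]].
pose gh := multiplicative_of (can2_gmulfM fK gK).
pose cg i : {multiplicative subgroup_type level_union -> infinite_cyclic} :=
  coord i \o gh.
have ghE i j : cg i (f (free_gen j)) = ((j == i)%:Z)%R.
  exact: etrans (congr1 (coord i) (fK _)) (coord_gen i j).
have I1 (i j : I) : i = j.
  apply/eqP/negPn/negP => ij.
  have := level_union_homs (cg i) (cg j) (f (free_gen i)) (f (free_gen j)).
  by rewrite !ghE !eqxx (negPf ij) eq_sym (negPf ij).
(* A basis with at most one element makes the union commutative, against the copy of F at level
   0. *)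
apply: free_two_noncommutative; apply: (@level_inj 0).
rewrite !gmulfM -!eltE -!valM.
by rewrite -[elt 0 A]gK -[elt 0 B]gK -!gmulfM (free_group_commutative I1).
Qed.

End FreeTwo.

(** The generator is [1%R]; the group identity [1] is the integer 0. *)
Lemma infinite_cyclic_hom (G : groupType)
    (f : {multiplicative infinite_cyclic -> G}) n :
  f n = zpow (f (1%R : int)) n.
Proof.
have fnat (k : nat) : f (k%:Z)%R = f (1%R : int) ^+ k.
  elim: k => [|k IHk]; first exact: (mult1 f).
  by rewrite expgS -IHk -gmulfM.
case: n => k; first exact: fnat.
by rewrite NegzE -[RHS]/((f (1%R : int)) ^- k.+1) -fnat -multV.
Qed.

Lemma mult_zpow (G K : groupType) (f : {multiplicative G -> K}) (x : G) n :
  f (zpow x n) = zpow (f x) n.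
Proof. exact: (infinite_cyclic_hom (f \o zpow x)). Qed.

(** * The splitting over the integers *)

Section IntegerAction.
Variables (N : groupType) (s : bijection N).
Hypothesis sM : {morph s : x y / x * y}.

Let zpowM n : {morph zpow s n : x y / x * y}.
Proof.
have natM (k : nat) : {morph bij_fun (s ^+ k) : x y / x * y}.
  elim: k => [//|k IHk] x y; rewrite expgS !bijME IHk; exact: sM.
case: n => k; first exact: natM.
apply: (can2_gmulfM (f := multiplicative_of (natM k.+1)));
  [apply: bij_funK | apply: bij_invK].
Qed.

Let int_act n : {multiplicative N -> N} := multiplicative_of (zpowM n).

Let int_act1 x : int_act 1 x = x. Proof. by []. Qed.

Let int_actM m n x : int_act (m * n) x = int_act m (int_act n x).
Proof.
exact: (congr1 (fun g : bijection N => g x) (gmulfM (s := zpow s) m n)).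
Qed.

Definition int_action : group_action infinite_cyclic N :=
  GroupAction int_act1 int_actM.

Local Notation sd := (semidirect int_action).

Let inl_fun (x : N) : sd := (x, 1).
Let inl_funM : {morph inl_fun : x y / x * y}.
Proof. by []. Qed.
Definition sd_inl := multiplicative_of inl_funM.

Let inr_fun (n : infinite_cyclic) : sd := (1, n).
Let inr_funM : {morph inr_fun : x y / x * y}.
Proof.
by move=> m n; congr (_, _); rewrite mul1g; apply/esym/(mult1 (int_action m)).
Qed.
Definition sd_inr := multiplicative_of inr_funM.

Lemma sd_inl_inr (x : sd) : x = sd_inl x.1 * sd_inr x.2.
Proof.
case: x => x n; congr (_, _); last exact/esym/mul1g.
by rewrite mult1 mulg1.
Qed.

Lemma sd_conj x : sd_inl (s x) ^ sd_inr (1%R : int) = sd_inl x.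
Proof.
rewrite conjgE; apply: (@mulgI _ (sd_inr (1%R : int))); rewrite mulVKg.
by congr (_, _); rewrite /= ?mult1 ?mulg1 ?mul1g.
Qed.

Variables (G : groupType) (f : {multiplicative N -> G}) (a : G).
Hypothesis fs : forall x, f (s x) ^ a = f x.

Let f_zpow n x : f (zpow s n x) = zpow a n * f x * (zpow a n)^-1.
Proof.
have natP (k : nat) y : f ((s ^+ k) y) = a ^+ k * f y * a ^- k.
  elim: k y => [|k IHk] y; first by rewrite invg1 mulg1 mul1g.
  rewrite expgSr bijME IHk -(fs y) conjgE expgSr invgM.
  by rewrite !mulgA !mulgK.
case: n => k; first exact: natP.
rewrite -[zpow a _]/(a ^- k.+1) -[zpow s _]/(s ^- k.+1) invgK.
by rewrite -{2}[x](bij_invK (s ^+ k.+1)) natP !mulgA mulVg mul1g mulgVK.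
Qed.

Let sd_fun (x : sd) : G := f x.1 * zpow a x.2.

Let sd_funM : {morph sd_fun : x y / x * y}.
Proof.
move=> [x m] [y n]; apply: (_ : f (x * zpow s m y) * zpow a (m * n) =
  f x * zpow a m * (f y * zpow a n)).
by rewrite !gmulfM f_zpow !mulgA mulgVK.
Qed.

(** The universal property of the semidirect product: a homomorphism on N, and an element of G whose
    conjugation realizes [s]. *)
Definition sd_lift := multiplicative_of sd_funM.

Lemma sd_lift_inl x : sd_lift (sd_inl x) = f x.
Proof. exact: mulg1. Qed.

Lemma sd_lift_inr n : sd_lift (sd_inr n) = zpow a n.
Proof. by apply: (_ : f 1 * zpow a n = _); rewrite mult1 mul1g. Qed.

End IntegerAction.

(** * The isomorphism of G with a semidirect product *)

Section MappingTorus.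
Local Notation F := (free_group 'I_3).
Local Notation X := (free_gen (inord 0) : F).
Local Notation Y := (free_gen (inord 1) : F).
Local Notation Z := (free_gen (inord 2) : F).

Let alpha : {multiplicative F -> F} := lift3 Y Z (Z * Y^-1 * X^-1 * Y * Z).
Let beta : {multiplicative F -> F} := lift3 (X * Y * Z^-1 * Y * X^-1) X Y.

Let alphaE : [/\ alpha X = Y, alpha Y = Z & alpha Z = Z * Y^-1 * X^-1 * Y * Z].
Proof. by rewrite /alpha !lift3E. Qed.

Let betaE : [/\ beta X = X * Y * Z^-1 * Y * X^-1, beta Y = X & beta Z = Y].
Proof. by rewrite /beta !lift3E. Qed.

Let alphaK : cancel alpha beta.
Proof.
have [[aX aY aZ] [bX bY bZ]] := (alphaE, betaE).
have gen_eq i : beta (alpha (free_gen i)) = free_gen i.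
  elim/ord3_ind: i; rewrite ?aX ?aY ?aZ ?bY ?bZ // !(gmulfM, multV) bX bY bZ.
  by rewrite !(invgM, invgK, mulgA) !(mulgK, mulgVK, mulgV, mulVg, mul1g).
by have := free_hom_eq (f := beta \o alpha) (g := idfun) gen_eq.
Qed.

Let betaK : cancel beta alpha.
Proof.
have [[aX aY aZ] [bX bY bZ]] := (alphaE, betaE).
have gen_eq i : alpha (beta (free_gen i)) = free_gen i.
  elim/ord3_ind: i; rewrite ?bX ?bY ?bZ ?aX ?aY // !(gmulfM, multV) aX aY aZ.
  by rewrite !(invgM, invgK, mulgA) !(mulgK, mulgVK, mulgV, mulVg, mul1g).
exact: (free_hom_eq (f := alpha \o beta) (g := idfun) gen_eq).
Qed.

Let aut := Bijection alphaK betaK.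
Let autM : {morph aut : x y / x * y} := gmulfM (s := alpha).

Let s : G_abt := abt_t / abt_a.

Let psi : {multiplicative F -> G_abt} :=
  lift3 ((s ^ abt_a) ^ abt_a) (s ^ abt_a) s.

Let psiE : [/\ psi X = (s ^ abt_a) ^ abt_a, psi Y = s ^ abt_a & psi Z = s].
Proof. by rewrite /psi !lift3E. Qed.

(** On X and Y this is the choice of [psi]; on Z it is where the relations of G enter. *)
Let psi_aut x : psi (aut x) ^ abt_a = psi x.
Proof.
have [[aX aY aZ] [pX pY pZ]] := (alphaE, psiE).
apply: (_ : psi (alpha x) ^ abt_a = psi x).
have conjM : {morph (fun z : G_abt => z ^ abt_a) : y z / y * z}.
  by move=> y z; apply: conjMg.
have gen_eq i : psi (alpha (free_gen i)) ^ abt_a = psi (free_gen i).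
  elim/ord3_ind: i; rewrite ?aX ?aY ?pX ?pY ?pZ //.
  rewrite aZ !(gmulfM, multV) pX pY pZ /s !conjgE.
  rewrite !(invgM, invgK, mulgA) !(mulgK, mulgVK, mulgV, mulVg, mul1g).
  (* The second relation with b replaced by t^-1 a t. *)
  have tt : abt_t^-1 * (abt_t^-1 * (abt_a * (abt_t * abt_t))) =
      abt_a * (abt_t^-1 * (abt_a * (abt_t * abt_a^-1))).
    by have := abt_rel_b; rewrite -abt_rel_a !mulgA.
  by rewrite -!mulgA tt !mulgA !(mulgK, mulgVK, mulgV, mulVg, mul1g).
pose psi' := multiplicative_of conjM \o psi \o alpha.
exact: (free_hom_eq (f := psi') (g := psi) gen_eq).
Qed.

Theorem abt_semidirect :
  exists theta : group_action infinite_cyclic F,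
    isomorphic G_abt (semidirect theta).
Proof.
exists (int_action autM).
pose u := sd_inr autM (1%R : int).
pose il := sd_inl autM.
have ilJ x : il (aut x) ^ u = il x by apply: sd_conj.
have [aX aY aZ] : [/\ aut X = Y, aut Y = Z &
  aut Z = Z * Y^-1 * X^-1 * Y * Z] := alphaE.
(* Moving every [u] to the right turns the two relations into identities in the free group on X, Y,
   Z. *)
have uil x p : p * u * il x = p * il (aut x) * u.
  by rewrite -(ilJ x) conjgE !mulgA mulgK.
have uil1 x : u * il x = il (aut x) * u by have := uil x 1; rewrite !mul1g.
have aut_u : aut (Y^-1 * Z) = Z^-1 * aut Z.
  by rewrite -aY; apply: etrans (gmulfM (s := alpha) _ _) _; rewrite multV.
have aut_uu : aut (Z^-1 * aut Z) = (aut Z)^-1 * aut (aut Z).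
  by apply: etrans (gmulfM (s := alpha) _ _) _; rewrite multV.
have aut_autZ : aut (aut Z) = aut Z * Z^-1 * Y^-1 * Z * aut Z.
  rewrite {1}aZ -[aut _]/(alpha _) !(gmulfM, multV) -![alpha _]/(aut _).
  by rewrite aX aY.
(* With [u] in the role of a, these images are forced by t = z a and b = t^-1 a t = y^-1 z a. *)
have [|| f [fa fb ft]] := @abt_lift _ u (il (Y^-1 * Z) * u) (il Z * u).
- apply: (@mulgI _ (il Z * u)); rewrite !mulgA mulgV mul1g uil1 !uil.
  by rewrite -gmulfM aut_u mulVKg.
- apply: (@mulgI _ (il Z * u)); rewrite !mulgA mulgV mul1g mulgK !uil.
  by rewrite -!gmulfM aut_u aut_uu aut_autZ !mulgA mulgVK mulgV mul1g.
pose g := sd_lift autM psi_aut.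
have g_inl x : g (il x) = psi x by apply: sd_lift_inl.
have g_u : g u = abt_a by apply: sd_lift_inr.
have [pX pY pZ] := psiE.
have fs : f s = il Z by rewrite gmulfM multV ft fa mulgK.
have f_psi x : f (psi x) = il x.
  have gen_eq i : f (psi (free_gen i)) = il (free_gen i).
    elim/ord3_ind: i; rewrite ?pX ?pY ?pZ ?multJ fs ?fa //.
      by rewrite -aY -aX !ilJ.
    by rewrite -aY ilJ.
  exact: (free_hom_eq (f := f \o psi) (g := il) gen_eq).
exists f, g.
  apply: (abt_hom_eq (f := g \o f) (g := idfun)).
  - exact: etrans (congr1 g fa) g_u.
  - apply: etrans (congr1 g fb) _.
    rewrite gmulfM g_inl g_u gmulfM multV pY pZ /s conjgE mulgVK invgM invgK.
    by rewrite !mulgA mulgVK abt_rel_a.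
  - apply: etrans (congr1 g ft) _.
    by rewrite gmulfM g_inl g_u pZ mulgVK.
move=> x; rewrite [x]sd_inl_inr gmulfM g_inl gmulfM f_psi; congr (_ * _).
rewrite [g _]sd_lift_inr mult_zpow fa; apply/esym/infinite_cyclic_hom.
Qed.

End MappingTorus.

Theorem proposition1 :
  (exists H : subgroup G_abt,
     locally_free (subgroup_type H) /\ ~ is_free (subgroup_type H)) /\
  (exists theta : group_action infinite_cyclic (free_group 'I_3),
     isomorphic G_abt (semidirect theta)).
Proof.
split; last exact: abt_semidirect.
exists level_union; split; first exact: level_union_locally_free.
exact: level_union_not_free.
Qed.
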